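(* Every almost polycyclic group is an RP-group.
   Context: A group is polycyclic if it has a finite subnormal series with cyclic factors ending in the trivial group. A group is almost polycyclic if it is an extension of a polycyclic group with a finite factor group, i.e. it has a normal polycyclic subgroup of finite index. For an endomorphism $\phi$ of a group $G$, elements $x,x'\in G$ are $\phi$-conjugate if $x'=gx\phi(g^{-1})$ for some $g\in G$; the equivalence classes are called $\phi$-conjugacy (Reidemeister) classes, and $R(\phi)$ is their number. For an automorphism $\phi$ of $G$, the characteristic function $f:G\to\{0,1\}$ of a $\phi$-conjugacy class is called periodic if there exist a finite group $K$, an automorphism $\phi_K$ of $K$ and an epimorphism $F:G\to K$ such that $F\circ\phi=\phi_K\circ F$ and $f=f_K\circ F$, where $f_K$ is the characteristic function of a subset of $K$. $G$ is an RP-group if for every automorphism $\phi$ of $G$ with $R(\phi)<\infty$ the characteristic functions of all $\phi$-conjugacy classes are periodic. *)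

(* Defs.v *)
From HB Require Import structures.
From mathcomp Require Import all_boot fingroup ssrint.
From mathcomp Require Import boolp classical_sets functions cardinality.

Set Implicit Arguments.
Unset Strict Implicit.
Unset Printing Implicit Defensive.

Local Open Scope classical_set_scope.
Local Open Scope group_scope.

Definition zexpg (G : groupType) (x : G) (k : int) : G :=
  match k with
  | Posz n => x ^+ n
  | Negz n => x ^- n.+1
  end.

Definition left_coset (G : groupType) (x : G) (N : set G) : set G :=
  [set x * y | y in N].

Definition normal_subgroup (G : groupType) (N H : set G) : Prop :=
  [/\ group_closed [in N], group_closed [in H], N `<=` H
    & forall h x, H h -> N x -> N (h * x * h^-1)].

(* Some coset [a N] generates [H / N]; powers in the quotient are
   [(a N) ^ k = (a ^ k) N]. *)
Definition cyclic_factor (G : groupType) (H N : set G) : Prop :=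
  exists2 a, H a &
    forall x, H x -> exists k : int, left_coset x N = left_coset (zexpg a k) N.

Definition polycyclic (G : groupType) (H : set G) : Prop :=
  group_closed [in H] /\
  exists (n : nat) (Hs : nat -> set G),
    [/\ Hs 0%N = H, Hs n = [set 1]
      & forall i, (i < n)%N ->
          normal_subgroup (Hs i.+1) (Hs i) /\ cyclic_factor (Hs i) (Hs i.+1)].

Definition almost_polycyclic (G : groupType) : Prop :=
  exists N : set G,
    [/\ normal_subgroup N [set: G], polycyclic N
      & finite_set [set left_coset x N | x in [set: G]]].

Definition reidemeister_class (G : groupType) (phi : {multiplicative G -> G})
    (x : G) : set G :=
  [set y | exists g, y = g * x * phi g^-1].

Definition reidemeister_classes (G : groupType)
    (phi : {multiplicative G -> G}) : set (set G) :=
  range (reidemeister_class phi).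

Definition periodic (G : groupType) (phi : {multiplicative G -> G})
    (f : G -> bool) : Prop :=
  exists (K : finGroupType) (phiK : {multiplicative K -> K})
         (F : {multiplicative G -> K}) (fK : {set K}),
    [/\ bijective phiK, range F = [set: K],
        F \o phi =1 phiK \o F
      & f =1 (fun k => k \in fK) \o F].

Definition RP_group (G : groupType) : Prop :=
  forall phi : {multiplicative G -> G}, bijective phi ->
    finite_set (reidemeister_classes phi) ->
    forall C, reidemeister_classes phi C -> periodic phi (fun x => x \in C).

(* Main.v *)
Require Import Defs.
From mathcomp Require Import all_boot fingroup.
From mathcomp Require Import ssrint morphism quotient.
From mathcomp Require Import boolp classical_sets functions cardinality.
From HB Require Import structures.

(** The twisted conjugacy classes of [phi] are the orbits of the action
    [g . x = g x phi(g)^-1] of [G] on itself.  The theorem says that these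
    orbits are open for the profinite topology, provided that there are only
    finitely many of them.

    A base of that topology is given by the subgroups [P_m] generated by all
    [m]-th powers.  In an almost polycyclic group each [P_m] has finite index
    ([powers_fin_idx]), each subgroup of finite index contains some [P_m]
    ([fin_idx_powers]), and [P_m] is preserved by all automorphisms.  An orbit
    that contains [x P_m] is, by translation, a union of cosets of [P_m], so its
    characteristic function factors through the finite group [G / P_m], on which
    [phi] induces an automorphism ([finite_quotient]).

    To find such a [P_m], descend along invariant subgroups: first a [P_m] inside
    a polycyclic subgroup of finite index, then its derived series, which reaches
    the trivial group.  Two properties are carried from [A] to the next term [B]:
    the stabilizer of each coset [A x] is finite modulo [A], and for all [m] the
    [P_m]-orbits are open modulo [A].  They are clear when [A] has finite index.
    Since [A / B] is abelian, the map [delta a = a x phi(a)^-1 x^-1] is an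
    endomorphism of [A / B], and the cosets of its image are the orbits of [A] on
    [A x] modulo [B].

    - The image of [delta] has finite index: finitely many orbits of [G] meet
      [A x], and the stabilizer of [A x], finite modulo [A], permutes the orbits
      of [A] inside each of them ([defect_image_fin_idx]).
    - Hence the kernel of [delta] is finite: in a finite quotient of [A / B] the
      kernel has as many elements as the cokernel, whose size is bounded, and
      distinct elements of the kernel stay distinct in some finite quotient
      ([kernel_fin_idx]).  So the stabilizer of [B x] is finite modulo [B].
    - If [g] in [P_k] sends [x] to [x p] modulo [A], with [p] in [P_k], then the
      error lies in the intersection of [A] and [P_k].  For suitable [k] this
      intersection consists, modulo [B], of values of [delta] on elements of
      [P_m], by which [g] is corrected to send [x] to [x p] modulo [B] ([open_orbits_step]).

    The last two points rest on Mal'cev's theorem that every subgroup of a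
    polycyclic-by-finite group is closed ([polyfin_closed]). *)

Set Implicit Arguments.
Unset Strict Implicit.
Unset Printing Implicit Defensive.

Local Open Scope classical_set_scope.
Local Open Scope group_scope.

(** Flattens a product and cancels adjacent inverse letters. *)
Ltac gsimp := rewrite ?(invgM, invgK, mulgA, mulgK, mulgVK, mulVg, mulgV,
  mul1g, mulg1, invg1).

(** * Subgroups, generation, products and finite index *)

Record subgroup (G : groupType) (H : set G) : Prop := Subgroup {
  sub1 : H 1;
  subM : forall x y, H x -> H y -> H (x * y);
  subV : forall x, H x -> H x^-1 }.

Definition normed_by (G : groupType) (H N : set G) :=
  forall h x, H h -> N x -> N (h * x * h^-1).

Definition gen (G : groupType) (S : set G) : set G :=
  [set x | forall K, subgroup K -> S `<=` K -> K x].

Definition powers (G : groupType) (H : set G) n : set G :=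
  gen [set x | exists2 h, H h & x = h ^+ n].

Definition derived (G : groupType) (H : set G) : set G :=
  gen [set x | exists h k, [/\ H h, H k & x = [~ h, k]]].

Definition mulset (G : groupType) (A B : set G) : set G :=
  [set x | exists a b, [/\ A a, B b & x = a * b]].

Definition fin_idx (G : groupType) (N H : set G) :=
  exists s : seq G, forall h, H h -> exists2 t, t \in s & N (t^-1 * h).

Section Morphisms.
Variables G H : groupType.

Lemma morph1_of (f : G -> H) : {morph f : x y / x * y} -> f 1 = 1.
Proof. by move=> fM; apply: (mulgI (f 1)); rewrite -fM !mulg1. Qed.

Lemma morphV_of (f : G -> H) : {morph f : x y / x * y} -> {morph f : x / x^-1}.
Proof.
by move=> fM x; apply: (mulgI (f x)); rewrite -fM !mulgV morph1_of.
Qed.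

Lemma morphX_of (f : G -> H) : {morph f : x y / x * y} ->
  forall n, {morph f : x / x ^+ n}.
Proof.
move=> fM n x; elim: n => [|n IH]; last by rewrite !expgS fM IH.
by rewrite !expg0 morph1_of.
Qed.

Lemma morphR_of (f : G -> H) : {morph f : x y / x * y} ->
  {morph f : x y / [~ x, y]}.
Proof. by move=> fM x y; rewrite /commg /conjg !fM !morphV_of. Qed.

Lemma mult1 (f : {multiplicative G -> H}) : f 1 = 1.
Proof. exact/morph1_of/gmulfM. Qed.

Lemma multV (f : {multiplicative G -> H}) : {morph f : x / x^-1}.
Proof. exact/morphV_of/gmulfM. Qed.

End Morphisms.

Section Basics.
Variable G : groupType.
Implicit Types (A B H K N S T : set G) (x y h g : G).

Lemma subX H x n : subgroup H -> H x -> H (x ^+ n).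
Proof.
move=> sH Hx; elim: n => [|n IH]; first by rewrite expg0; apply: sub1.
by rewrite expgS; apply: subM.
Qed.

Lemma subMr H x y : subgroup H -> H y -> H (x * y) <-> H x.
Proof.
move=> sH Hy; split=> [Hxy|Hx]; last exact: subM.
by rewrite -(mulgK y x); apply: subM => //; apply: subV.
Qed.

Lemma subgroupI H K : subgroup H -> subgroup K -> subgroup (H `&` K).
Proof.
move=> sH sK; split; first by split; apply: sub1.
  by move=> x y [? ?] [? ?]; split; apply: subM.
by move=> x [? ?]; split; apply: subV.
Qed.

Lemma subgroupT : subgroup [set: G]. Proof. by []. Qed.

Lemma gen_subgroup S : subgroup (gen S).
Proof.
split=> [K sK _|x y Sx Sy K sK SK|x Sx K sK SK]; first exact: sub1.
  by apply: (subM sK); [apply: Sx|apply: Sy].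
by apply: (subV sK); apply: Sx.
Qed.

Lemma sub_gen S : S `<=` gen S.
Proof. by move=> x Sx K _ SK; apply: SK. Qed.

Lemma gen_min S K : subgroup K -> S `<=` K -> gen S `<=` K.
Proof. by move=> sK SK x; apply. Qed.

(** The source of all invariance statements about verbal subgroups; stated for
    bare functions so that it covers conjugations, [phi] and the inverse of
    [phi] alike. *)
Lemma gen_morph (f : G -> G) S T : {morph f : x y / x * y} ->
  (forall x, S x -> gen T (f x)) -> forall x, gen S x -> gen T (f x).
Proof.
move=> fM fS; apply: gen_min => //; have sT := gen_subgroup T; split; rewrite /=.
- by rewrite morph1_of //; apply: (sub1 sT).
- by move=> x y ? ?; rewrite fM; apply: (subM sT).
- by move=> x ?; rewrite morphV_of //; apply: (subV sT).
Qed.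

Lemma conj_morph g : {morph (fun x => g * x * g^-1) : x y / x * y}.
Proof. by move=> x y; gsimp. Qed.

Lemma powers_subgroup H n : subgroup (powers H n).
Proof. exact: gen_subgroup. Qed.

Lemma powers_min H n K :
  subgroup K -> (forall h, H h -> K (h ^+ n)) -> powers H n `<=` K.
Proof. by move=> sK HK; apply: gen_min => // x [h Hh ->]; apply: HK. Qed.

Lemma mem_powers H n h : H h -> powers H n (h ^+ n).
Proof. by move=> Hh; apply: sub_gen; exists h. Qed.

Lemma powers_sub H n : subgroup H -> powers H n `<=` H.
Proof. by move=> sH; apply: powers_min => // h Hh; apply: subX. Qed.

Lemma powersM H m n : powers H (m * n) `<=` powers H m `&` powers H n.
Proof.
move=> x Px; split; move: x Px; apply: powers_min; try exact: powers_subgroup.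
  move=> h Hh; rewrite expgnA; apply: (subX n (powers_subgroup H m)).
  exact: mem_powers.
move=> h Hh; rewrite mulnC expgnA; apply: (subX m (powers_subgroup H n)).
exact: mem_powers.
Qed.

Lemma powers_morph (f : G -> G) H n : {morph f : x y / x * y} ->
  (forall x, H x -> H (f x)) -> forall x, powers H n x -> powers H n (f x).
Proof.
move=> fM fH; apply: gen_morph => // x [h Hh ->].
by rewrite morphX_of //; apply: mem_powers; apply: fH.
Qed.

Lemma powers_normed H N n : normed_by H N -> normed_by H (powers N n).
Proof.
move=> nN h x Hh; apply: (powers_morph (conj_morph h)) => y; exact: nN.
Qed.

Lemma derived_subgroup H : subgroup (derived H).
Proof. exact: gen_subgroup. Qed.

Lemma mem_derived H h k : H h -> H k -> derived H [~ h, k].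
Proof. by move=> Hh Hk; apply: sub_gen; exists h, k. Qed.

Lemma derived_min H K : subgroup K ->
  (forall h k, H h -> H k -> K [~ h, k]) -> derived H `<=` K.
Proof. by move=> sK HK; apply: gen_min => // x [h [k [? ? ->]]]; apply: HK. Qed.

Lemma derived_sub H : subgroup H -> derived H `<=` H.
Proof.
move=> sH; apply: derived_min => // h k Hh Hk; rewrite /commg /conjg.
by do 3?apply: (subM sH) => //; apply: (subV sH).
Qed.

Lemma derived_morph (f : G -> G) H : {morph f : x y / x * y} ->
  (forall x, H x -> H (f x)) -> forall x, derived H x -> derived H (f x).
Proof.
move=> fM fH; apply: gen_morph => // x [h [k [? ? ->]]].
by rewrite morphR_of //; apply: mem_derived; apply: fH.
Qed.

Lemma mulset_subgroup A B : subgroup A -> subgroup B -> normed_by A B ->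
  subgroup (mulset A B).
Proof.
move=> sA sB nB; split.
- by exists 1, 1; rewrite mulg1; split=> //; apply: sub1.
- move=> _ _ [a [b [Aa Bb ->]]] [a' [b' [Aa' Bb' ->]]].
  exists (a * a'), (a'^-1 * b * a'^-1^-1 * b'); split; last by gsimp.
    exact: subM.
  by apply: subM => //; apply: nB => //; apply: subV.
- move=> _ [a [b [Aa Bb ->]]].
  exists a^-1, (a * b^-1 * a^-1); split; last by gsimp.
    exact: subV.
  by apply: nB => //; apply: subV.
Qed.

Lemma fin_idxS N N' H H' : N `<=` N' -> H' `<=` H -> fin_idx N H -> fin_idx N' H'.
Proof.
move=> NN HH [s sP]; exists s => h /HH /sP [t ts /NN]; by exists t.
Qed.

Lemma fin_idx_right N H : subgroup N -> subgroup H ->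
  (exists s : seq G, forall h, H h -> exists2 t, t \in s & N (h * t^-1)) ->
  fin_idx N H.
Proof.
move=> sN sH [s sP]; exists [seq t^-1 | t <- s] => h Hh.
have [t ts Nt] := sP _ (subV sH Hh); exists t^-1; first exact: map_f.
by have := subV sN Nt; gsimp.
Qed.

Lemma fin_idx_trans N M H : subgroup H -> M `<=` H -> fin_idx N M ->
  fin_idx M H -> fin_idx N H.
Proof.
move=> sH MH [s sP] [r rP]; exists [seq t * u | t <- r, u <- s] => h Hh.
have [t tr Mt] := rP h Hh; have [u us Nu] := sP _ Mt.
exists (t * u); first exact: allpairs_f.
by move: Nu; gsimp.
Qed.

Lemma fin_idxI A N H : subgroup A -> subgroup N -> subgroup H -> A `<=` H ->
  fin_idx N H -> fin_idx (A `&` N) A.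
Proof.
move=> sA sN sH AH [s sP].
pose good t a := A a /\ N (t^-1 * a).
pose r t := xget 1 [set a | good t a].
exists [seq r t | t <- s] => a Aa; have [t ts Nt] := sP a (AH a Aa).
exists (r t); first exact: map_f.
have [Ar Nr] : good t (r t) by apply: (@xgetPex _ 1 [set a | good t a]); exists a.
split; first by apply: subM => //; apply: subV.
by have := subM sN (subV sN Nr) Nt; gsimp.
Qed.

(** Among [size s + 1] successive powers of [h] two lie in the same coset of [N],
    so some power with exponent at most [size s] lies in [N], and the factorial
    is a multiple of all these exponents. *)
Lemma fin_idx_exponent N H : subgroup H -> subgroup N -> fin_idx N H ->
  exists2 n, (0 < n)%N & forall h, H h -> N (h ^+ n).
Proof.
move=> sH sN [s sP]; exists (size s)`!; first exact: fact_gt0.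
move=> h Hh; have /choice [r rP] : forall i, exists t, t \in s /\ N (t^-1 * h ^+ i).
  by move=> i; have [t ts Nt] := sP _ (subX i sH Hh); exists t.
pose l := map r (iota 0 (size s).+1).
have : ~~ uniq l.
  apply/negP => /uniq_leq_size -/(_ s).
  rewrite size_map size_iota ltnn => H0; apply: (notF); apply: H0 => t.
  by case/mapP => i _ ->; case: (rP i).
move/(uniqPn 1) => [i [j [ij]]]; rewrite size_map size_iota => js.
rewrite !(nth_map 0%N) ?size_iota ?(ltn_trans ij) //.
rewrite !nth_iota ?(ltn_trans ij) // !add0n => rij.
have Nij : N (h ^+ (j - i)).
  have := subM sN (subV sN (rP i).2) (rP j).2; rewrite rij; gsimp.
  by rewrite -{1}(subnKC (ltnW ij)) expgnDr; gsimp.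
have : (j - i %| (size s)`!)%N.
  by apply: dvdn_fact; rewrite subn_gt0 ij (leq_trans (leq_subr _ _)).
by case/dvdnP => k ->; rewrite mulnC expgnA; apply: subX.
Qed.

Lemma fin_idx_powers N H : subgroup H -> subgroup N -> fin_idx N H ->
  exists2 n, (0 < n)%N & powers H n `<=` N.
Proof.
move=> sH sN /(fin_idx_exponent sH sN) [n n0 nP]; exists n => //.
exact: powers_min.
Qed.

End Basics.

(** * Poly-(finite or cyclic) groups and their closed subgroups *)

Definition cyc (G : groupType) (a : G) : set G :=
  [set x | exists i j : nat, x = a ^+ i * a ^- j].

(** A polycyclic series with a finite top layer becomes uniform when finite layers
    are admitted everywhere.  Finite cyclic layers count among these; that the
    others are infinite lets a cyclic supplement of [N] meet [N] trivially. *)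
Inductive polyfin (G : groupType) : set G -> Prop :=
| Polyfin1 : polyfin [set 1]
| PolyfinFinite H N : subgroup H -> subgroup N -> N `<=` H -> normed_by H N ->
    polyfin N -> fin_idx N H -> polyfin H
| PolyfinCyclic H N a : subgroup H -> subgroup N -> N `<=` H ->
    normed_by H N -> polyfin N -> H a ->
    (forall h, H h -> exists2 c, cyc a c & N (c^-1 * h)) ->
    (forall i, N (a ^+ i) -> i = 0%N) -> polyfin H.

(** Closedness in the profinite topology: the open sets [f P_m] form a base of
    neighbourhoods of [f]. *)
Definition closed_subgroups (G : groupType) (H : set G) :=
  forall B, subgroup B -> B `<=` H -> forall f, H f -> ~ B f ->
  exists2 m, (0 < m)%N & ~ mulset B (powers H m) f.

Section Polyfin.
Variable G : groupType.
Implicit Types (A B H K N L : set G) (x y h g a : G).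

Lemma powersS N H n : N `<=` H -> powers N n `<=` powers H n.
Proof.
move=> NH; apply: powers_min; first exact: powers_subgroup.
by move=> h /NH; apply: mem_powers.
Qed.

Lemma subgroup_normed H : subgroup H -> normed_by H H.
Proof.
by move=> sH h x Hh Hx; apply: (subM sH); [exact: subM|exact: subV].
Qed.

Lemma mulset1l A B : subgroup A -> B `<=` mulset A B.
Proof. by move=> sA b Bb; exists 1, b; rewrite mul1g; split=> //; apply: sub1. Qed.

Lemma mulset1r A B : subgroup B -> A `<=` mulset A B.
Proof. by move=> sB a Aa; exists a, 1; rewrite mulg1; split=> //; apply: sub1. Qed.

Lemma mulset_min A B K : subgroup K -> A `<=` K -> B `<=` K -> mulset A B `<=` K.
Proof. by move=> sK AK BK _ [a [b [/AK ? /BK ? ->]]]; apply: subM. Qed.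

Lemma mulsetS A B B' : B `<=` B' -> mulset A B `<=` mulset A B'.
Proof. by move=> BB x [a [b [? /BB ? ->]]]; exists a, b. Qed.

Lemma commuteXXV a i j : commute (a ^+ i) (a ^- j).
Proof. by apply: commuteV; apply: commuteX2; apply: commute_refl. Qed.

Lemma cycM a i j k l :
  a ^+ i * a ^- j * (a ^+ k * a ^- l) = a ^+ (i + k) * a ^- (l + j).
Proof.
rewrite !expgnDr invgM !mulgA; congr (_ * _).
by rewrite -!mulgA -[in LHS](commuteXXV a k j).
Qed.

Lemma cyc_subgroup a : subgroup (cyc a).
Proof.
split; first by exists 0%N, 0%N; rewrite !expg0; gsimp.
  move=> _ _ [i [j ->]] [k [l ->]]; exists (i + k)%N, (l + j)%N.
  exact: cycM.
by move=> _ [i [j ->]]; exists j, i; gsimp.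
Qed.

Lemma cyc_id a i : cyc a (a ^+ i).
Proof. by exists i, 0%N; rewrite expg0; gsimp. Qed.

Lemma cyc_sub a H : subgroup H -> H a -> cyc a `<=` H.
Proof.
move=> sH Ha _ [i [j ->]].
by apply: (subM sH); [|apply: (subV sH)]; apply: (subX _ sH).
Qed.

(** Adjoining to [N] a positive power of a generator of [H / N] costs only finite
    index. *)
Lemma fin_idx_cyclic H N L a d : subgroup L -> N `<=` L ->
  (forall h, H h -> exists2 c, cyc a c & N (c^-1 * h)) ->
  (0 < d)%N -> L (a ^+ d) -> fin_idx L H.
Proof.
move=> sL NL HN d0 Lad; exists [seq a ^+ r | r <- iota 0 d] => h Hh.
have [_ [i [j ->]] /NL Lh] := HN h Hh.
(* [k] is congruent to [i - j] modulo [d], without a subtraction. *)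
pose k := (i + j * d.-1)%N; exists (a ^+ (k %% d)).
  by apply: map_f; rewrite mem_iota /= ltn_mod.
have Ld e : L (a ^+ (e * d)) by rewrite mulnC expgnA; apply: (subX _ sL).
have : L ((a ^+ (k %/ d * d)) * a ^- (j * d)).
  by apply: (subM sL) => //; apply: (subV sL).
move=> /(subM sL)/(_ Lh).
suff -> : a ^+ (k %/ d * d) * a ^- (j * d) = a ^- (k %% d) * (a ^+ i * a ^- j).
  by rewrite -!mulgA; gsimp.
apply: (mulgI (a ^+ (k %% d))); rewrite !mulgA -expgnDr addnC -divn_eq mulgV mul1g.
apply: (mulIg (a ^+ (j * d))); rewrite mulgVK -mulgA /k expgnDr; congr (_ * _).
by rewrite -{2}(prednK d0) mulnS expgnDr mulKg.
Qed.

Lemma mulset_fin_idx B Q N L : subgroup N -> subgroup (mulset B N) ->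
  subgroup Q -> subgroup L -> B `<=` L -> Q `<=` L ->
  fin_idx Q N -> fin_idx L (mulset B N).
Proof.
move=> sN sBN sQ sL BL QL [s sP]; apply: fin_idx_right => //.
exists [seq t^-1 | t <- s] => _ [b [u [Bb Nu ->]]].
have [t ts Qt] := sP _ (subV sN Nu); exists t^-1; first exact: map_f.
rewrite invgK -mulgA; apply: (subM sL); first exact: BL.
by apply: QL; have := subV sQ Qt; gsimp.
Qed.

(** In a cyclic layer, [powers H n] contains the subgroup [powers N n], of finite
    index in [N], and the power [a ^+ n] of the generator. *)
Lemma powers_fin_idx H n : (0 < n)%N -> polyfin H -> fin_idx (powers H n) H.
Proof.
move=> n0; elim=> {H} [|H N sH sN NH nN _ IH fN|H N a sH sN NH nN _ IH Ha HN _].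
- exists [:: 1] => _ ->; exists 1; first by rewrite inE.
  by gsimp; apply: (sub1 (powers_subgroup _ _)).
- apply: (fin_idx_trans sH NH) fN.
  by apply: fin_idxS IH => //; apply: powersS.
have sP := powers_subgroup H n.
have nP : normed_by H (powers H n) by apply: powers_normed; apply: subgroup_normed.
have PH : powers H n `<=` H by apply: powers_sub.
have sM : subgroup (mulset (powers H n) N).
  by apply: mulset_subgroup => // h x /PH; apply: nN.
apply: (@fin_idx_trans _ _ (mulset (powers H n) N)) => //.
- exact: mulset_min.
- apply: (mulset_fin_idx sN sM _ sP _ _ IH) => //; last exact: powersS.
  exact: powers_subgroup.
- apply: (fin_idx_cyclic sM _ HN n0); first exact: mulset1l.
  by apply: mulset1r => //; apply: mem_powers.
Qed.

Lemma closed_via H B L f : subgroup H -> subgroup L -> fin_idx L H -> B `<=` L ->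
  ~ L f -> exists2 m, (0 < m)%N & ~ mulset B (powers H m) f.
Proof.
move=> sH sL fL BL nLf; have [m m0 mP] := fin_idx_powers sH sL fL.
by exists m => // /(mulset_min sL BL mP).
Qed.

(** If [B N] has finite index, then an element outside [B N] is separated by [B N].
    An element [b u] of [B N] outside [B] has [u] outside [B `&` N]; separating
    these in [N] by [Q = powers N m], the subgroup [B Q], still of finite index,
    separates [b u] from [B]. *)
Lemma closed_step H N B f : subgroup H -> subgroup N -> N `<=` H ->
  normed_by H N -> polyfin N -> closed_subgroups N ->
  subgroup B -> B `<=` H -> fin_idx (mulset B N) H -> H f -> ~ B f ->
  exists2 m, (0 < m)%N & ~ mulset B (powers H m) f.
Proof.
move=> sH sN NH nN pN cN sB BH fBN Hf nBf.
have sBN : subgroup (mulset B N) by apply: mulset_subgroup => // h x /BH; apply: nN.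
have [BNf|nBNf] := pselect (mulset B N f); last first.
  exact: (closed_via sH sBN fBN (mulset1r sN)).
have [b [u [Bb Nu fE]]] := BNf.
have nBu : ~ (B `&` N) u.
  by case=> Bu _; apply: nBf; rewrite fE; apply: (subM sB).
have [m m0 mP] := cN _ (subgroupI sB sN) (@subIsetr _ _ _) u Nu nBu.
have nQ : normed_by H (powers N m) by apply: powers_normed.
have sL : subgroup (mulset B (powers N m)).
  apply: mulset_subgroup => //; first exact: powers_subgroup.
  by move=> h x /BH; apply: nQ.
have QN : powers N m `<=` N by apply: powers_sub.
apply: (closed_via sH sL _ (mulset1r (powers_subgroup N m))).
  apply: (fin_idx_trans sH _ _ fBN); first exact: mulset_min.
  have sQ := powers_subgroup N m.
  apply: (mulset_fin_idx sN sBN sQ sL _ _ (powers_fin_idx m0 pN)).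
    exact: mulset1r.
  exact: mulset1l.
case=> b' [q [Bb' Qq E]]; apply: mP; exists (b^-1 * b'), q; split=> //.
  split; first by apply: (subM sB) => //; apply: (subV sB).
  have -> : b^-1 * b' = u * q^-1 by apply: (mulgI b); rewrite !mulgA -fE E; gsimp.
  by apply: (subM sN) => //; apply: (subV sN); apply: QN.
by apply: (mulgI b); rewrite !mulgA -fE E; gsimp.
Qed.

(** Mal'cev's theorem, by induction over the layers.  The case that
    [closed_step] leaves out is a subgroup [B] of [N] with [H / N] infinite
    cyclic.  An element outside [N] is excluded by [N <a ^+ d>] for large [d].
    For an element of [N], choose [Q = powers N m] by induction; the subgroup
    [Q <a>] has finite index and meets [N] in [Q] only, so it contains some
    [powers H k], whose intersection with [N] then lies in [Q]. *)
Lemma polyfin_closed H : polyfin H -> closed_subgroups H.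
Proof.
elim=> {H} [|H N sH sN NH nN pN cN fN|H N a sH sN NH nN pN cN Ha HN ainf].
- by move=> B sB B1 f -> []; apply: (sub1 sB).
- move=> B sB BH f Hf nBf; apply: (closed_step sH sN) => //.
  by apply: fin_idxS fN => //; apply: mulset1l.
move=> B sB BH f Hf nBf.
have cycN i j : N (a ^+ i * a ^- j) -> i = j.
  wlog le_ji : i j / (j <= i)%N => [hw|].
    case: (leqP j i) => [|/ltnW] le Nij; first exact: hw.
    by apply/esym/hw => //; have := subV sN Nij; gsimp.
  by rewrite -expgnFr // => /ainf/eqP; rewrite subn_eq0 => le; apply/eqP;
    rewrite eqn_leq le.
have [BN|] := pselect (B `<=` N); last first.
  (* [b] gives [B N] a positive power of [a], hence finite index in [H]. *)
  move=> /existsNP[b /not_implyP[Bb nNb]].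
  have sBN : subgroup (mulset B N) by apply: mulset_subgroup => // h x /BH; apply: nN.
  apply: (closed_step sH sN) => //.
  have [_ [i [j ->]] Nb] := HN b (BH b Bb).
  have BNb : mulset B N (a ^+ i * a ^- j).
    exists b, ((a ^+ i * a ^- j)^-1 * b)^-1; split=> //; last by gsimp.
    exact: (subV sN).
  have [ij|ji|ij] := ltngtP i j.
  - apply: (fin_idx_cyclic sBN (mulset1l sB) HN (d := j - i)).
      by rewrite subn_gt0.
    by rewrite expgnFr ?(ltnW ij) //; have := subV sBN BNb; gsimp.
  - apply: (fin_idx_cyclic sBN (mulset1l sB) HN (d := i - j)).
      by rewrite subn_gt0.
    by rewrite expgnFr ?(ltnW ji).
  by case: nNb; move: Nb; rewrite ij mulgV; gsimp.
have cN' c K : H c -> normed_by H K -> normed_by (cyc c) K.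
  by move=> Hc nK h x /(cyc_sub sH Hc); apply: nK.
have [Nf|nNf] := pselect (N f); last first.
  have [_ [i [j ->]] Nf] := HN f Hf.
  (* [i] and [j] are smaller than [d]: congruent modulo [d], they are equal. *)
  pose d := (i + j).+1; have Had : H (a ^+ d) by apply: subX.
  have sL : subgroup (mulset (cyc (a ^+ d)) N).
    by apply: mulset_subgroup => //; [apply: cyc_subgroup|apply: cN'].
  have NL : N `<=` mulset (cyc (a ^+ d)) N by apply: mulset1l; apply: cyc_subgroup.
  apply: (closed_via sH sL) => [|x /BN /NL //|].
    apply: (fin_idx_cyclic sL NL HN (d := d)) => //.
    by apply: mulset1r => //; apply: (cyc_id _ 1).
  case=> _ [u [[k [l ->]] Nu fE]]; apply: nNf.
  suff ij : i = j by move: Nf; rewrite ij mulgV; gsimp.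
  have /cycN : N (a ^+ (i + d * l) * a ^- (j + d * k)).
    move: Nf; rewrite fE mulgA -!expgnA => /(subMr _ sN Nu)/(subV sN).
    by gsimp; rewrite -mulgA cycM [(d * l + _)%N]addnC.
  move=> /(congr1 (modn^~ d)).
  rewrite ![(_ + d * _)%N]addnC ![(d * _)%N]mulnC !modnMDl !modn_small //.
    by rewrite /d ltnS leq_addl.
  by rewrite /d ltnS leq_addr.
have [m m0 mP] := cN B sB BN f Nf nBf.
have nQ : normed_by H (powers N m) by apply: powers_normed.
have QN : powers N m `<=` N by apply: powers_sub.
have sM : subgroup (mulset (cyc a) (powers N m)).
  apply: mulset_subgroup; [exact: cyc_subgroup|exact: powers_subgroup|exact: cN'].
have fM : fin_idx (mulset (cyc a) (powers N m)) H.
  have [s sP] := powers_fin_idx m0 pN.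
  exists s => h Hh.
  have [c ac Nh] := HN _ (subV sH Hh); have [t ts Qt] := sP _ (subV sN Nh).
  exists t => //; exists c^-1, (c * (t^-1 * (c^-1 * h^-1)^-1) * c^-1).
  split; last by gsimp.
    exact: (subV (cyc_subgroup a)).
  by apply: nQ => //; apply: cyc_sub ac.
have [k k0 kP] := fin_idx_powers sH sM fM.
exists k => // -[b [p [Bb Pp fE]]]; apply: mP; exists b, p; split=> //.
have Np : N p.
  have -> : p = b^-1 * f by rewrite fE mulKg.
  by apply: (subM sN) => //; apply: (subV sN); apply: BN.
have [_ [q [[i [j ->]] Qq pE]]] := kP p Pp.
have /cycN ij : N (a ^+ i * a ^- j).
  by move: Np; rewrite pE => /(subMr _ sN (QN _ Qq)).
by rewrite pE ij; gsimp.
Qed.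

End Polyfin.

(** * Almost polycyclic groups *)

Definition cong (G : groupType) (N : set G) (x y : G) := N (x^-1 * y).

Section Cong.
Variables (G : groupType) (H N : set G).
Hypotheses (sH : subgroup H) (sN : subgroup N) (nN : normed_by H N).
Implicit Types x y z : G.

Lemma cong_refl x : cong N x x.
Proof. by rewrite /cong mulVg; apply: (sub1 sN). Qed.

Lemma cong_sym x y : cong N x y -> cong N y x.
Proof. by move=> /(subV sN); rewrite /cong; gsimp. Qed.

Lemma cong_trans y x z : cong N x y -> cong N y z -> cong N x z.
Proof. by rewrite /cong => Nxy /(subM sN Nxy); gsimp. Qed.

Lemma congM x x' y y' : H y -> cong N x x' -> cong N y y' ->
  cong N (x * y) (x' * y').
Proof.
rewrite /cong => Hy Nx Ny.
have -> : (x * y)^-1 * (x' * y') =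
  y^-1 * (x^-1 * x') * y^-1^-1 * (y^-1 * y') by gsimp.
by apply: (subM sN) => //; apply: nN => //; apply: (subV sH).
Qed.

Lemma congV x y : H x -> cong N x y -> cong N x^-1 y^-1.
Proof.
rewrite /cong => Hx /cong_sym Nxy.
have -> : x^-1^-1 * y^-1 = x * (y^-1 * x) * x^-1 by gsimp.
exact: nN.
Qed.

End Cong.

Section Almost.
Variable G : groupType.
Implicit Types (A B H K N L : set G) (x y h g a : G).

Lemma group_closed_subgroup H : group_closed [in H] -> subgroup H.
Proof.
move=> [H1 HB]; have H1' : H 1 by move: H1; rewrite inE.
have HB' x y : H x -> H y -> H (x * y^-1).
  by move=> Hx Hy; have := HB x y; rewrite !inE; apply.
have HV x : H x -> H x^-1 by move=> /(HB' _ _ H1'); gsimp.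
by split=> // x y Hx /HV Hy; have := HB' _ _ Hx Hy; gsimp.
Qed.

Lemma zexpg_cyc a k : cyc a (zexpg a k).
Proof.
case: k => n /=; first exact: cyc_id.
by exists 0%N, n.+1; rewrite expg0; gsimp.
Qed.

Lemma left_coset_eq N x y : subgroup N -> left_coset x N = left_coset y N ->
  N (y^-1 * x).
Proof.
move=> sN E; have : left_coset x N x by exists 1; [apply: sub1|rewrite mulg1].
by rewrite E => -[u Nu <-]; gsimp.
Qed.

Lemma cyclic_factor_cyc H N : subgroup N -> cyclic_factor H N ->
  exists2 a, H a & forall h, H h -> exists2 c, cyc a c & N (c^-1 * h).
Proof.
move=> sN [a Ha aP]; exists a => // h Hh; have [k E] := aP h Hh.
by exists (zexpg a k); [apply: zexpg_cyc|apply: left_coset_eq].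
Qed.

Lemma polyfin_layer H N : normal_subgroup N H -> cyclic_factor H N ->
  polyfin N -> polyfin H.
Proof.
move=> [/group_closed_subgroup sN /group_closed_subgroup sH NH nN].
move=> /(cyclic_factor_cyc sN)[a Ha HN] pN.
have [[d d0 Nd]|inf] := pselect (exists2 d, (0 < d)%N & N (a ^+ d)).
  apply: (PolyfinFinite sH sN NH nN pN).
  exact: (fin_idx_cyclic sN _ HN d0 Nd).
apply: (PolyfinCyclic sH sN NH nN pN Ha HN) => i Ni.
by apply/eqP; rewrite -leqn0 leqNgt; apply/negP => i0; apply: inf; exists i.
Qed.

Lemma polycyclic_polyfin H : polycyclic H -> polyfin H.
Proof.
move=> [_ [n [Hs [<- Hn HsP]]]].
suff pf i : (i <= n)%N -> polyfin (Hs (n - i)%N).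
  by have := pf n (leqnn n); rewrite subnn.
elim: i => [|i IH] lt_in; first by rewrite subn0 Hn; apply: Polyfin1.
have [|nH cH] := HsP (n - i.+1)%N; first by rewrite ltn_subrL (leq_trans _ lt_in).
by apply: (polyfin_layer nH cH); rewrite -subSn // subSS; apply/IH/ltnW.
Qed.

(** Cyclic groups are abelian. *)
Lemma derived_cyclic H N : normal_subgroup N H -> cyclic_factor H N ->
  derived H `<=` N.
Proof.
move=> [/group_closed_subgroup sN /group_closed_subgroup sH NH nN].
move=> /(cyclic_factor_cyc sN)[a Ha HN].
apply: derived_min => // h k Hh Hk.
have [c ac Nc] := HN h Hh; have [d ad Nd] := HN k Hk.
have cd : commute c d.
  move: ac ad => [i [j ->]] [p [q ->]].
  by rewrite /commute !cycM addnC [(q + j)%N]addnC.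
have Hd := cyc_sub sH Ha ad; have Hc := cyc_sub sH Ha ac.
have hk : cong N (c * d) (h * k) by apply: (congM sH sN nN).
have kh : cong N (c * d) (k * h) by rewrite cd; apply: (congM sH sN nN).
have -> : [~ h, k] = (k * h)^-1 * (h * k) by rewrite /commg /conjg; gsimp.
exact: cong_trans (cong_sym sN kh) hk.
Qed.

End Almost.

Section Series.
Variable G : groupType.
Implicit Types (A B H K N L : set G) (x y h g a : G).

Lemma finite_cosets_fin_idx N : subgroup N ->
  finite_set [set left_coset x N | x in [set: G]] -> fin_idx N [set: G].
Proof.
move=> sN /finite_seqP[s sE].
pose r (C : set G) := xget 1 [set x | left_coset x N = C].
exists [seq r C | C <- s] => h _.
have hs : left_coset h N \in s.
  have : [set left_coset x N | x in [set: G]] (left_coset h N) by exists h.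
  by rewrite sE.
exists (r (left_coset h N)); first exact: map_f.
apply: left_coset_eq => //; apply/esym.
by apply: (@xgetPex _ 1 [set x | left_coset x N = left_coset h N]); exists h.
Qed.

Lemma derivedS A B : A `<=` B -> derived A `<=` derived B.
Proof.
move=> AB; apply: derived_min => [|h k /AB ? /AB ?]; first exact: derived_subgroup.
exact: mem_derived.
Qed.

(** Fully invariant subgroups replace the given polycyclic series, which no
    automorphism need respect: [powers [set: G] m] lies in the polycyclic subgroup,
    and each derivation step descends at least one layer of its series. *)
Lemma almost_polycyclic_series : almost_polycyclic G ->
  polyfin [set: G] /\
  exists m n, (0 < m)%N /\ iter n (@derived G) (powers [set: G] m) `<=` [set 1].
Proof.
move=> [N [nN pN fN]]; have [/group_closed_subgroup sN _ _ nN'] := nN.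
have fiN := finite_cosets_fin_idx sN fN.
split; first exact: (PolyfinFinite _ sN _ nN' (polycyclic_polyfin pN)).
have [m m0 mP] := fin_idx_powers (@subgroupT G) sN fiN.
have [_ [n [Hs [H0 Hn HsP]]]] := pN.
exists m, n; split=> //; rewrite -Hn.
suff it i : (i <= n)%N ->
  iter i (@derived G) (powers [set: G] m) `<=` Hs i by apply: it.
elim: i => [_|i IH lt_in] /=; first by rewrite H0.
have [nH cH] := HsP i lt_in.
exact: subset_trans (derivedS (IH (ltnW lt_in))) (derived_cyclic nH cH).
Qed.

End Series.

(** * Invariant subgroups and their finite quotients *)

Record invariant (G : groupType) (phi : {multiplicative G -> G}) (A : set G) : Prop :=
  Invariant {
    inv_sub : subgroup A;
    inv_normal : normed_by [set: G] A;
    inv_phi : forall a, A (phi a) <-> A a }.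

Section Invariant.
Variables (G : groupType) (phi : {multiplicative G -> G}).
Hypothesis phi_bij : bijective phi.
Implicit Types (A B H K N L : set G) (x y h g a : G).

Lemma invariantT : invariant phi [set: G]. Proof. by []. Qed.

(** Invariance under conjugation, [phi] and its inverse are three instances of the
    functoriality of [V]. *)
Lemma invariant_functor (V : set G -> set G) A :
  (forall H, subgroup (V H)) ->
  (forall (f : G -> G) H, {morph f : x y / x * y} ->
    (forall x, H x -> H (f x)) -> forall x, V H x -> V H (f x)) ->
  invariant phi A -> invariant phi (V A).
Proof.
move=> sV mV [sA nA phiA]; split=> //.
  by move=> h x _; apply: (mV _ _ (conj_morph h)) => y; apply: nA.
have [psi phiK psiK] := phi_bij.
have psiM : {morph psi : x y / x * y}.
  by move=> x y; apply: (can_inj phiK); rewrite gmulfM !psiK.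
move=> a; split=> [|Va]; last by apply: mV Va => [x y|x /phiA //]; rewrite gmulfM.
by rewrite -{2}(phiK a); apply: mV => // x; rewrite -{1}(psiK x) => /phiA.
Qed.

Lemma invariant_powers A n : invariant phi A -> invariant phi (powers A n).
Proof.
apply: (invariant_functor (V := fun H => powers H n)) => [H|f H].
  exact: powers_subgroup.
exact: powers_morph.
Qed.

Lemma invariant_derived A : invariant phi A -> invariant phi (derived A).
Proof. exact: (invariant_functor (@derived_subgroup G) (@derived_morph G)). Qed.

Lemma invariant_mulset A B : invariant phi A -> invariant phi B ->
  invariant phi (mulset A B).
Proof.
move=> [sA nA pA] [sB nB pB]; split.
- by apply: mulset_subgroup => // h x _; apply: nB.
- move=> h _ _ [a [b [Aa Bb ->]]].
  exists (h * a * h^-1), (h * b * h^-1); split; last by gsimp.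
    exact: nA.
  exact: nB.
have [psi phiK psiK] := phi_bij.
move=> x; split=> -[a [b [Aa Bb E]]]; last first.
  by exists (phi a), (phi b); rewrite E gmulfM; split=> //; [apply/pA|apply/pB].
exists (psi a), (psi b); split; [apply/pA|apply/pB|]; rewrite ?psiK //.
by apply: (can_inj phiK); rewrite gmulfM !psiK.
Qed.

(** The quotient [G / N], carried by a finite list of coset representatives: [rho g]
    is the first member of [s] in the coset of [g]. *)
Lemma finite_quotient N : invariant phi N -> fin_idx N [set: G] ->
  exists (K : finGroupType) (phiK : {multiplicative K -> K})
         (F : {multiplicative G -> K}),
    [/\ bijective phiK, range F = [set: K], F \o phi =1 phiK \o F
      & forall g h, F g = F h <-> N (g^-1 * h)].
Proof.
move=> [sN nN pN] [s sP].
pose rho g := nth 1 s (find (fun t => `[<N (t^-1 * g)>]) s).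
have has_rho g : has (fun t => `[<N (t^-1 * g)>]) s.
  by apply/hasP; have [t ts Nt] := sP g Logic.I; exists t => //; apply/asboolP.
have rho_s g : rho g \in s by rewrite mem_nth // -has_find.
have rhoN g : N ((rho g)^-1 * g).
  by apply/asboolP; apply: (nth_find 1 (has_rho g)).
have rho_eq g h : rho g = rho h <-> N (g^-1 * h).
  split=> [E|Ngh].
    by have := subM sN (subV sN (rhoN g)) (rhoN h); rewrite E; gsimp.
  rewrite /rho; congr nth; apply: eq_find => t; apply/asbool_equiv_eq.
  have -> : t^-1 * h = t^-1 * g * (g^-1 * h) by gsimp.
  by symmetry; apply: subMr.
have rhoK g : rho (rho g) = rho g by apply/rho_eq.
pose T := seq_sub (map rho s).
have rho_map g : rho g \in map rho s by rewrite -rhoK map_f.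
pose F0 g : T := SeqSub (rho_map g).
have F0_eq g h : F0 g = F0 h <-> N (g^-1 * h).
  by rewrite -rho_eq; split=> [[]|E] //; apply: val_inj.
have F0_val (u : T) : F0 (val u) = u.
  by apply: val_inj => /=; have /mapP[t _ ->] := ssvalP u; apply: rhoK.
have F0_mul g h g' h' : F0 g = F0 g' -> F0 h = F0 h' -> F0 (g * h) = F0 (g' * h').
  by move=> /F0_eq Ng /F0_eq Nh; apply/F0_eq; apply: (congM (@subgroupT G) sN nN).
pose mulT (u v : T) : T := F0 (val u * val v).
pose invT (u : T) : T := F0 (val u)^-1.
have mulTA : associative mulT.
  move=> u v w; transitivity (F0 (val u * val v * val w)).
    by rewrite -mulgA; apply: F0_mul => //; apply: F0_val.
  by apply: F0_mul => //; rewrite F0_val.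
have mul1T : left_id (F0 1) mulT.
  move=> u; rewrite -[RHS]F0_val -[in RHS](mul1g (val u)).
  by apply: F0_mul => //; apply: F0_val.
have mulVT : left_inverse (F0 1) invT mulT.
  move=> u; rewrite /mulT -(mulVg (val u)).
  by apply: F0_mul => //; apply: F0_val.
pose K : finGroupType := HB.pack T (Finite_isGroup.Build T mulTA mul1T mulVT).
pose F1 : G -> K := F0.
have F1M : {morph F1 : x y / x * y}.
  by move=> x y; apply: F0_mul; rewrite F0_val.
pose F : {multiplicative G -> K} := HB.pack F1 (isMultiplicative.Build _ _ F1 F1M).
pose p1 : K -> K := fun u => F1 (phi (val u)).
have p1F g : p1 (F1 g) = F1 (phi g).
  apply/F0_eq; rewrite -multV -gmulfM; apply/pN; apply/F0_eq; exact: F0_val.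
have p1M : {morph p1 : x y / x * y}.
  move=> x y; rewrite -(F0_val x) -(F0_val y).
  by rewrite -[in LHS]F1M !p1F gmulfM F1M.
pose pK : {multiplicative K -> K} := HB.pack p1 (isMultiplicative.Build _ _ p1 p1M).
exists K, pK, F; split=> //.
- apply: injF_bij => u v; rewrite -(F0_val u) -(F0_val v) /=.
  rewrite !p1F => /F0_eq; rewrite -multV -gmulfM => /pN Nuv; exact/F0_eq.
- by apply/seteqP; split=> // u _; exists (val u) => //; apply: F0_val.
- by move=> g /=; rewrite p1F.
Qed.

End Invariant.

(** * Twisted conjugation modulo an abelian layer *)

Definition twist (G : groupType) (phi : {multiplicative G -> G}) (g x : G) :=
  g * x * (phi g)^-1.

(** How far [g] is from fixing [x]; on an abelian layer this is the endomorphism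
    [1 - psi], where [psi a = x phi(a) x^-1]. *)
Definition defect (G : groupType) (phi : {multiplicative G -> G}) (x g : G) :=
  twist phi g x * x^-1.

(** The stabilizer of the coset [A x]. *)
Definition stab (G : groupType) (phi : {multiplicative G -> G}) (A : set G)
    (x : G) : set G := [set g | A (defect phi x g)].

(** The orbit of [x] under [powers [set: G] m] contains a neighbourhood of [x],
    modulo [A].  Passing from one invariant subgroup to the next uses this
    property with [m] replaced by a multiple. *)
Definition open_orbits (G : groupType) (phi : {multiplicative G -> G})
    (A : set G) :=
  forall x m, (0 < m)%N -> exists2 n, (0 < n)%N &
    forall p, powers [set: G] n p ->
      exists2 g, powers [set: G] m g & cong A (x * p) (twist phi g x).

(** An endomorphism of a finite group has as many elements in its kernel as there
    are cosets of its image. *)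
Lemma card_ker_leq (K : finGroupType) (A : {group K}) (d : K -> K) (l : seq K) :
  {in A &, {morph d : u v / u * v}} ->
  (forall a, a \in A -> exists2 t, t \in l & exists2 c, c \in A & a = t * d c) ->
  (#|[set a in A | d a == 1%g]%SET| <= size l)%N.
Proof.
move=> dM lP; pose f := Morphism dM.
have kerE : [set a in A | d a == 1%g]%SET = ('ker f)%g.
  by apply/setP => a; rewrite inE; apply/idP/idP => [/andP[Aa /eqP da]|/morphpreP[Aa]];
    [apply/kerP|rewrite inE => /eqP /= -> ; rewrite Aa eqxx].
have cardA : (#|A| = #|'ker f| * #|f @* A|)%N.
  by rewrite card_morphim finset.setIid Lagrange //; apply: subsetIl.
have : (#|A| <= size l * #|f @* A|)%N.
  pose l' := [seq t * v | t <- l, v <- enum (f @* A)%g].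
  have -> : (size l * #|f @* A|)%N = size l' by rewrite size_allpairs -cardE.
  apply: leq_trans (card_size l'); apply/subset_leq_card/fintype.subsetP => a /lP.
  move=> [t tl [c Ac ->]]; apply: allpairs_f => //.
  by rewrite mem_enum; apply/morphimP; exists c.
by rewrite cardA kerE leq_pmul2r // cardG_gt0.
Qed.

Section Twisted.
Variables (G : groupType) (phi : {multiplicative G -> G}).
Hypothesis phi_bij : bijective phi.
Hypothesis polyG : polyfin [set: G].
Variable orb : seq G.
Hypothesis orbP : forall y, exists2 x, x \in orb & exists g, y = twist phi g x.
Implicit Types (A B H K N L : set G) (x y h g a b c u : G).

Lemma twistM g h x : twist phi (g * h) x = twist phi g (twist phi h x).
Proof. by rewrite /twist gmulfM; gsimp. Qed.

Lemma twistMr g a x : twist phi g (a * x) = g * a * g^-1 * twist phi g x.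
Proof. by rewrite /twist; gsimp. Qed.

Lemma twist1 x : twist phi 1 x = x.
Proof. by rewrite /twist mult1; gsimp. Qed.

Lemma defectM x c c' :
  defect phi x (c * c') = c * defect phi x c' * c^-1 * defect phi x c.
Proof. by rewrite /defect /twist gmulfM; gsimp. Qed.

Lemma defectV x c : defect phi x c^-1 = c^-1 * (defect phi x c)^-1 * c.
Proof. by rewrite /defect /twist multV; gsimp. Qed.

Lemma defect1 x : defect phi x 1 = 1.
Proof. by rewrite /defect twist1; gsimp. Qed.

Lemma defect_in A x c : invariant phi A -> A c -> A (defect phi x c).
Proof.
move=> [sA nA pA] Ac.
have -> : defect phi x c = c * (x * (phi c)^-1 * x^-1) by rewrite /defect /twist; gsimp.
by apply: (subM sA) => //; apply: nA => //; apply: (subV sA); apply/pA.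
Qed.

Lemma stab_subgroup A x : invariant phi A -> subgroup (stab phi A x).
Proof.
move=> [sA nA pA]; split; rewrite /stab /=.
- by rewrite defect1; apply: (sub1 sA).
- by move=> g h Ag Ah; rewrite defectM; apply: (subM sA) => //; apply: nA.
- by move=> g Ag; rewrite defectV; have := nA g^-1 _ Logic.I (subV sA Ag); rewrite invgK.
Qed.

Lemma powersT_inv n : invariant phi (powers [set: G] n).
Proof. by apply: invariant_powers => //; apply: invariantT. Qed.

Lemma open_orbits_fin_idx A : invariant phi A -> fin_idx A [set: G] ->
  open_orbits phi A.
Proof.
move=> iA fA x m m0; have [sA nA _] := iA.
have [n n0 nP] := fin_idx_powers (@subgroupT G) sA fA.
exists n => // p /nP Ap; exists 1; first exact: (sub1 (powers_subgroup _ _)).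
by rewrite /cong twist1; have := subV sA Ap; gsimp.
Qed.

(** Closedness separates one element; the product of the exponents serves for
    finitely many. *)
Lemma separate_seq B (l : seq G) : subgroup B -> {in l, forall f, ~ B f} ->
  exists2 m, (0 < m)%N & {in l, forall f, ~ mulset B (powers [set: G] m) f}.
Proof.
move=> sB; elim: l => [_|f l IH lP]; first by exists 1%N.
have [m m0 mP] : exists2 m, (0 < m)%N &
    {in l, forall f, ~ mulset B (powers [set: G] m) f}.
  by apply: IH => h hl; apply: lP; rewrite inE hl orbT.
have nf : ~ B f by apply: lP; rewrite inE eqxx.
have [k k0 kP] := polyfin_closed polyG sB (@subsetT _ _) (f := f) Logic.I nf.
exists (m * k)%N; first by rewrite muln_gt0 m0.
move=> h; rewrite inE => /orP[/eqP ->|/mP mh] hB.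
  by apply: kP; move: hB; apply: mulsetS => y /powersM[].
by apply: mh; move: hB; apply: mulsetS => y /powersM[].
Qed.

(** The profinite topology of [G] induces that of [A]: some [powers [set: G] m]
    avoids the finitely many nontrivial cosets of [D] in [A], because [D] is
    closed in [G]. *)
Lemma powers_in_fin_idx A D : subgroup A -> subgroup D -> fin_idx D A ->
  exists2 m, (0 < m)%N & powers [set: G] m `&` A `<=` D.
Proof.
move=> sA sD [s sP].
have [|m m0 mP] := @separate_seq D [seq t <- s | ~~ `[< D t >]] sD.
  by move=> t; rewrite mem_filter => /andP[/asboolPn].
exists m => // p [Pp Ap]; have [t ts Dt] := sP p Ap.
have [Dt'|nDt] := pselect (D t); first by rewrite -(mulVKg t p); apply: (subM sD).
have : t \in [seq t <- s | ~~ `[< D t >]] by rewrite mem_filter ts andbT; apply/asboolPn.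
case/mP; exists (t^-1 * p)^-1, (t^-1 * p * p * (t^-1 * p)^-1).
split; last by gsimp.
  exact: subV.
exact: (inv_normal (powersT_inv m)).
Qed.

(** The subgroup [delta(C) B] of [A], for [delta] the defect at [x]. *)
Definition defect_image A B x C : set G :=
  [set a | A a /\ exists2 c, C c & cong B (defect phi x c) a].

Section Step.
Variables A B : set G.
Hypotheses (iA : invariant phi A) (iB : invariant phi B).
Hypotheses (BA : B `<=` A) (AB : derived A `<=` B).

Let sA := inv_sub iA.
Let sB := inv_sub iB.
Let nA := inv_normal iA.
Let nB := inv_normal iB.

(** [A / B] is abelian. *)
Lemma cong_conj a b : A a -> A b -> cong B a (b * a * b^-1).
Proof.
move=> Aa Ab; apply: AB; have := mem_derived Aa (subV sA Ab).
by rewrite /commg /conjg; gsimp.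
Qed.

Lemma cong_mul x x' y y' : cong B x x' -> cong B y y' -> cong B (x * y) (x' * y').
Proof. by move=> Bx By; apply: (congM (@subgroupT G) sB nB). Qed.

Lemma cong_defectM x c c' : A c -> A c' ->
  cong B (defect phi x (c * c')) (defect phi x c * defect phi x c').
Proof.
move=> Ac Ac'; rewrite defectM.
have [Ad Ad'] := (defect_in x iA Ac, defect_in x iA Ac').
apply: (cong_trans sB (y := defect phi x c' * defect phi x c)).
  by apply: cong_mul; [apply: (cong_sym sB); apply: cong_conj|apply: cong_refl].
rewrite -[X in cong B _ X](mulgK (defect phi x c)).
apply: (cong_trans sB (y := defect phi x c *
  (defect phi x c' * defect phi x c) * (defect phi x c)^-1)).
  by apply: cong_conj => //; apply: subM.
by rewrite !mulgA; apply: cong_refl.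
Qed.

Lemma defect_image_subgroup x C : subgroup C -> C `<=` A ->
  subgroup (defect_image A B x C).
Proof.
move=> sC CA; split.
- split; first exact: sub1.
  by exists 1; [apply: sub1|rewrite defect1; apply: cong_refl].
- move=> a a' [Aa [c Cc ca]] [Aa' [c' Cc' ca']]; split; first exact: subM.
  exists (c * c'); first exact: subM.
  by apply: (cong_trans sB (cong_defectM x (CA _ Cc) (CA _ Cc'))); apply: cong_mul.
- move=> a [Aa [c Cc ca]]; split; first exact: subV.
  exists c^-1; first exact: subV.
  rewrite defectV; apply: (cong_trans sB (y := (defect phi x c)^-1)).
    have Ac := CA _ Cc; have Ad := subV sA (defect_in x iA Ac).
    by apply: (cong_sym sB); have := cong_conj Ad (subV sA Ac); rewrite invgK.
  exact: (congV sB nB).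
Qed.

(** The cosets of [delta(A) B] are the orbits of [A] on [A x] modulo [B].  Choose
    in each orbit of [G] that meets [A x] one point of [A x].  Any other point
    [a x] of that orbit is its image under an element of the stabilizer of [A x],
    that is, under [b t] with [b] in [A] and [t] in a finite list. *)
Lemma defect_image_fin_idx x : fin_idx A (stab phi A x) ->
  fin_idx (defect_image A B x A) A.
Proof.
move=> [s sP].
pose Q y a := A a /\ exists h, a * x = twist phi h y.
pose r y := xget 1 [set a | Q y a].
exists [seq twist phi t (r y * x) * x^-1 | t <- s, y <- orb].
move=> a Aa; have [y yorb [g ay]] := orbP (a * x).
have [Ar [h rE]] : Q y (r y).
  by apply: (@xgetPex _ 1 [set a | Q y a]); exists a; split=> //; exists g.
have kE : a * x = twist phi (g * h^-1) (r y * x).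
  by rewrite rE -twistM mulgVK ay.
have [t ts At] : exists2 t, t \in s & A (t^-1 * (g * h^-1)).
  apply: sP; rewrite /stab /= /defect.
  move: kE; rewrite twistMr; set k := g * h^-1 => kE.
  have -> : twist phi k x * x^-1 = (k * r y * k^-1)^-1 * a.
    by apply: (mulIg x); rewrite mulgVK -mulgA kE mulKg.
  by apply: (subM sA) => //; apply: (subV sA); apply: nA.
exists (twist phi t (r y * x) * x^-1); first by apply: allpairs_f.
set w := _ * x^-1; pose b := t * (t^-1 * (g * h^-1)) * t^-1.
have Ab : A b by apply: nA.
have aE : a = b * w * b^-1 * defect phi x b.
  apply: (mulIg x); have bt : g * h^-1 = b * t by rewrite /b; gsimp.
  rewrite kE bt twistM -(mulgVK x (twist phi t _)) -/w twistMr /defect.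
  by rewrite [in RHS]mulgA mulgVK.
have Ad := defect_in x iA Ab; clearbody w b.
have Aw : A w.
  have -> : w = b^-1 * (a * (defect phi x b)^-1) * b^-1^-1 by rewrite aE; gsimp.
  by apply: nA => //; apply: (subM sA) => //; apply: (subV sA).
split; first by apply: (subM sA) => //; apply: (subV sA).
exists b => //; have -> : w^-1 * a = w^-1 * (b * w * b^-1) * defect phi x b.
  by rewrite aE mulgA.
rewrite -[X in cong B X]mul1g; apply: cong_mul (cong_refl sB _).
by have := cong_conj Aw Ab; rewrite /cong; gsimp.
Qed.

Lemma defect_image_sub_fin_idx x C : subgroup C -> C `<=` A -> fin_idx C A ->
  fin_idx (defect_image A B x C) (defect_image A B x A).
Proof.
move=> sC CA [s sP]; exists [seq defect phi x t | t <- s] => a [Aa [c Ac ca]].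
have [t ts Ct] := sP c Ac; exists (defect phi x t); first exact: map_f.
have At : A t.
  have -> : t = c * (t^-1 * c)^-1 by gsimp.
  by apply: (subM sA) => //; apply: (subV sA); apply: CA.
have Ad := defect_in x iA At.
split; first by apply: (subM sA) => //; apply: (subV sA).
exists (t^-1 * c) => //.
have := cong_defectM x At (CA _ Ct); rewrite mulVKg => /(cong_sym sB) E.
have := cong_trans sB E ca.
by rewrite /cong; gsimp.
Qed.

(** Let [g] send [x] to [x p] modulo [A].  If [g] and [p] lie in [powers [set: G] k],
    so does the error [a].  Moved through [g], it becomes an element [b] of [A] in
    [powers [set: G] k], so that [b] is congruent to [delta c] with [c] in
    [powers [set: G] m]; then [g c] sends [x] to [x p] modulo [B]. *)
Lemma open_orbits_step : (forall x, fin_idx A (stab phi A x)) ->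
  open_orbits phi A -> open_orbits phi B.
Proof.
move=> fA oA x m m0.
have sPm k := powers_subgroup [set: G] k; have iP k := powersT_inv k.
pose C := A `&` powers [set: G] m.
have sC : subgroup C by apply: subgroupI.
have CA : C `<=` A by move=> ? [].
have fC : fin_idx C A.
  apply: (fin_idxI sA (sPm m) (@subgroupT G)) => //; exact: powers_fin_idx.
have fD : fin_idx (defect_image A B x C) A.
  apply: (fin_idx_trans sA _ (defect_image_sub_fin_idx x sC CA fC)).
    by move=> ? [].
  exact: defect_image_fin_idx.
have [k k0 kP] := powers_in_fin_idx sA (defect_image_subgroup x sC CA) fD.
have [|n n0 nP] := oA x (m * k)%N; first by rewrite muln_gt0 m0.
exists (n * k)%N; first by rewrite muln_gt0 n0.
move=> p /powersM[Pn Pk]; have [g /powersM[gm gk] Ag] := nP p Pn.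
set a := (x * p)^-1 * twist phi g x.
have Pa : powers [set: G] k a.
  have -> : a = p^-1 * (x^-1 * g * x^-1^-1) * (phi g)^-1.
    by rewrite /a /twist; gsimp.
  apply: (subM (sPm k)); last by apply: (subV (sPm k)); apply/(inv_phi (iP k)).
  by apply: (subM (sPm k)); [apply: (subV (sPm k))|apply: (inv_normal (iP k))].
pose e := x * (phi g)^-1; pose b := e * a^-1 * e^-1.
have xpE : x * p = g * b * g^-1 * twist phi g x.
  by rewrite /b /e /a /twist; gsimp.
have [_ [c [Ac Pc] cb]] : defect_image A B x C b.
  by apply: kP; split; [apply: (inv_normal (iP k)) => //; apply: (subV (sPm k))|
    apply: nA => //; apply: (subV sA)].
exists (g * c); first exact: (subM (sPm m)).
have -> : twist phi (g * c) x = g * defect phi x c * g^-1 * twist phi g x.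
  by rewrite twistM -twistMr /defect mulgVK.
rewrite xpE; clearbody b; set t := twist phi g x; set d := defect phi x c in cb *.
clearbody t d; rewrite /cong.
have -> : (g * b * g^-1 * t)^-1 * (g * d * g^-1 * t) =
  (t^-1 * g) * (b^-1 * d) * (t^-1 * g)^-1 by gsimp.
by apply: nB => //; apply: (cong_sym sB).
Qed.

(** Otherwise a list of pairwise incongruent elements could always be extended. *)
Lemma fin_idx_bounded S r : (forall l : seq G, (forall u, u \in l -> S u) ->
    pairwise (fun u v => ~~ `[< cong B v u >]) l -> (size l <= r)%N) ->
  fin_idx B S.
Proof.
move=> Sr; apply: contrapT => nfin.
have ex n : exists l : seq G, [/\ forall u, u \in l -> S u,
    pairwise (fun u v => ~~ `[< cong B v u >]) l & size l = n].
  elim: n => [|n [l [lS lp ls]]]; first by exists [::].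
  have [g [Sg gl]] : exists g, S g /\ forall t, t \in l -> ~ cong B t g.
    apply: contrapT => ng; apply: nfin; exists l => g Sg.
    apply: contrapT => nt; apply: ng; exists g; split=> // t tl ct.
    by apply: nt; exists t.
  exists (g :: l); split; last by rewrite /= ls.
  - by move=> u; rewrite inE => /orP[/eqP -> //|/lS].
  - by rewrite /= lp andbT; apply/allP => t tl; apply/asboolPn; apply: gl.
have [l [lS lp ls]] := ex r.+1.
by have := Sr l lS lp; rewrite ls ltnn.
Qed.

(** Suppose that [l] lists pairwise incongruent elements of the kernel of [delta].
    As [B] is closed, their images in some finite quotient [K] of [G], whose kernel
    contains [B], are distinct.  They lie in the kernel of the endomorphism that
    [delta] induces on the image of [A], and the index of its image is at most that
    of [delta(A) B] in [A]. *)
Lemma kernel_fin_idx x : fin_idx A (stab phi A x) ->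
  fin_idx B (A `&` stab phi B x).
Proof.
move=> /defect_image_fin_idx [s sP]; apply: (@fin_idx_bounded _ (size s)) => l lS lp.
pose diffs := [seq c <- [seq v^-1 * u | u <- l, v <- l] | ~~ `[< B c >]].
have [|m m0 mP] := @separate_seq B diffs sB.
  by move=> c; rewrite mem_filter => /andP[/asboolPn].
pose E := mulset B (powers [set: G] m).
have iE : invariant phi E by apply: invariant_mulset => //; apply: powersT_inv.
have sE := inv_sub iE.
have fE : fin_idx E [set: G].
  apply: fin_idxS (powers_fin_idx m0 polyG) => //; exact: mulset1l.
have [K [pK [F [_ _ FpK FE]]]] := finite_quotient iE fE.
pose A1 := [set k | `[< exists2 a, A a & F a = k >]]%SET.
have gA1 : group_set A1.
  apply/group_setP; split;
    first by rewrite !inE; exists 1; [apply: (sub1 sA)|apply: mult1].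
  move=> u v; rewrite !inE => -[a Aa <-] [b Ab <-].
  by exists (a * b); [apply: (subM sA)|rewrite gmulfM].
pose d k := k * F x * (pK k)^-1 * (F x)^-1.
have dF a : d (F a) = F (defect phi x a).
  by rewrite /d /defect /twist !gmulfM !multV; have /= -> := FpK a.
have FB u v : cong B u v -> F u = F v.
  by move=> Buv; apply/FE; apply: (mulset1r (powers_subgroup _ _)).
have : (#|[set k in A1 | d k == 1%g]%SET| <= size (map F s))%N.
  apply: (@card_ker_leq K (Group gA1) d).
    move=> u v; rewrite !inE => -[a Aa <-] [b Ab <-].
    by rewrite -gmulfM !dF -gmulfM; apply/FB/cong_defectM.
  move=> u; rewrite !inE => -[a Aa <-]; have [t ts [_ [c Ac cc]]] := sP a Aa.
  exists (F t); first exact: map_f.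
  exists (F c); first by rewrite !inE; exists c.
  by rewrite dF (FB _ _ cc) -gmulfM mulVKg.
rewrite size_map; apply: leq_trans.
have uF : uniq (map F l).
  rewrite uniq_pairwise pairwise_map; apply: (sub_in_pairwise (P := [in l])) lp; last first.
    exact/allP.
  move=> u v ul vl /asboolPn nB'; apply/eqP => Fuv.
  apply: (mP (v^-1 * u)); last exact/FE.
  rewrite mem_filter; apply/andP; split; first exact/asboolPn.
  by apply/allpairsP; exists (u, v).
rewrite -(size_map F); move/card_uniqP: uF => <-.
apply/subset_leq_card/fintype.subsetP => k /mapP[a al ->].
have [Aa Ba] := lS a al; rewrite !inE; apply/andP; split.
  by apply/asboolP; exists a.
by rewrite dF -(mult1 F); apply/eqP/esym/FB; rewrite /cong invg1 mul1g.
Qed.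

(** The stabilizer of [B x] is contained in that of [A x], and it meets [A] in the
    kernel of [delta]. *)
Lemma stab_step x : fin_idx A (stab phi A x) -> fin_idx B (stab phi B x).
Proof.
move=> fA.
have [sS sS'] := (stab_subgroup x iB, stab_subgroup x iA).
have BAS : stab phi B x `<=` stab phi A x by move=> g /BA.
have := fin_idxI sS sA sS' BAS fA; rewrite classical_sets.setIC.
by apply: (fin_idx_trans sS) (kernel_fin_idx fA) => ? [].
Qed.

End Step.

Lemma open_orbits_derived A n : invariant phi A -> fin_idx A [set: G] ->
  open_orbits phi (iter n (@derived G) A).
Proof.
move=> iA fA; pose D i := iter i (@derived G) A.
suff DP i : [/\ invariant phi (D i), forall x, fin_idx (D i) (stab phi (D i) x)
    & open_orbits phi (D i)] by case: (DP n).
elim: i => [|i [iD fD oD]].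
  split=> [//|x|]; last exact: open_orbits_fin_idx.
  exact: fin_idxS fA.
have iD' : invariant phi (D i.+1) by apply: invariant_derived.
have DD : D i.+1 `<=` D i := derived_sub (inv_sub iD).
split=> // [x|]; first exact: (stab_step iD iD' DD (@subset_refl _ _) (fD x)).
exact: (open_orbits_step iD iD' (@subset_refl _ _) fD).
Qed.

End Twisted.

(** * Periodicity of the classes *)

Theorem theorem4p6 (G : groupType) : almost_polycyclic G -> RP_group G.
Proof.
move=> apG phi phi_bij finR C [x _ <-].
have [polyG [m [n [m0 trivial_n]]]] := almost_polycyclic_series apG.
have [orb orbP] : exists orb : seq G,
    forall y, exists2 x, x \in orb & exists g, y = twist phi g x.
  have /finite_seqP[s sE] := finR.
  pose r (C : set G) := xget 1 [set x | reidemeister_class phi x = C].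
  exists (map r s) => y; pose Cy := reidemeister_class phi y.
  exists (r Cy).
    apply: map_f; have : reidemeister_classes phi Cy by exists y.
    by rewrite sE.
  have rE : reidemeister_class phi (r Cy) = Cy.
    by apply: (@xgetPex _ 1 [set x | reidemeister_class phi x = Cy]); exists y.
  have : Cy y by exists 1; rewrite invg1 mult1; gsimp.
  by rewrite -{1}rE => -[g E]; exists g; rewrite /twist -multV.
have iP k : invariant phi (powers [set: G] k).
  by apply: invariant_powers => //; apply: invariantT.
have fP k : (0 < k)%N -> fin_idx (powers [set: G] k) [set: G].
  by move=> k0; apply: powers_fin_idx.
have [k k0 kP] :=
  open_orbits_derived phi_bij polyG orbP n (iP m) (fP m m0) x (ltn0Sn 0).
have [K [phiK [F [bijK FT FphiK FE]]]] := finite_quotient (iP k) (fP k k0).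
exists K, phiK, F,
  [set u | `[< exists2 y, reidemeister_class phi x y & F y = u >]]%SET.
split=> // y; rewrite /= !inE; apply/asboolP/asboolP => [xy|[z [g ->] /FE Pzy]].
  by exists y.
(* [y] is the image of [x q] under [g], and [x q] lies in the orbit of [x]. *)
pose q := (phi g)^-1 * ((g * x * phi g^-1)^-1 * y) * (phi g)^-1^-1.
have [h _ /trivial_n hE] := kP q (inv_normal (iP k) (h := (phi g)^-1) Logic.I Pzy).
exists (g * h); rewrite multV -/(twist phi (g * h) x) twistM.
have -> : twist phi h x = x * q by rewrite -[RHS]mulg1 -[1 in RHS]hE mulVKg.
by rewrite /twist /q multV; gsimp.
Qed.
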